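(* Every quiver $Q$ constructed from a triangulation of an unpunctured surface has a symmetric twin. The twin is unique up to simultaneous sign changes of rows and columns: if $A=(a_{ij})$ and $\tilde A=(\tilde a_{ij})$ are symmetric twins of $Q$, then there are signs $\epsilon_1,\dots,\epsilon_n\in\{\pm1\}$ with $\tilde a_{ij}=\epsilon_i\epsilon_j a_{ij}$ for all $i,j$.
   Context: A quiver $Q$ with vertices $1,\dots,n$ is identified with an integer skew-symmetric $n\times n$ matrix $B=(b_{ij})$: if $b_{ij}>0$ there are $b_{ij}$ arrows from $i$ to $j$. The mutation $\mu_k(Q)$ is the quiver of $B'=(b'_{ij})$ with $b'_{ij}=-b_{ij}$ if $i=k$ or $j=k$, and $b'_{ij}=b_{ij}+\frac12(|b_{ik}|b_{kj}+b_{ik}|b_{kj}|)$ otherwise. An unpunctured surface is a compact connected oriented surface with at least one boundary component and a finite set of marked points, all on the boundary, with at least one marked point on every boundary component; it is assumed to admit a triangulation with at least one interior arc. A triangulation is a maximal collection of pairwise non-crossing, pairwise non-isotopic simple arcs with endpoints at marked points (not contractible and not isotopic to boundary segments); it cuts the surface into triangles. Its quiver has the arcs (interior edges) as vertices; each triangle contributes one arrow between every two of its sides that are arcs, the arrows inside a triangle being directed counter-clockwise; pairs of opposite arrows cancel. A quasi-Cartan companion of $Q$ is a symmetric $n\times n$ matrix $A=(a_{ij})$ with $a_{ii}=2$ and $|a_{ij}|=|b_{ij}|$ for $i\ne j$. Mutation of companions: $\mu_k(A)=(a'_{ij})$ with $a'_{ii}=2$; $a'_{ik}=a'_{ki}=\mathrm{sgn}(b_{ik})a_{ik}$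 for $i\ne k$; and $a'_{ij}=a_{ij}-\mathrm{sgn}(a_{ik}a_{kj})[b_{ik}b_{kj}]_+$ for distinct $i,j\neq k$, where $[x]_+=\max(x,0)$. For a mutation sequence, $Q$ and $A$ are mutated simultaneously step by step. A quasi-Cartan companion $A$ of $Q$ is a symmetric twin of $Q$ if for every mutation sequence $\mu$ the matrix $\mu(A)$ is a quasi-Cartan companion of $\mu(Q)$. *)

(* Defs.v *)
From HB Require Import structures.
From mathcomp Require Import all_boot all_order all_algebra.

Set Implicit Arguments.
Unset Strict Implicit.
Unset Printing Implicit Defensive.

Import Order.TTheory GRing.Theory Num.Theory.
Local Open Scope ring_scope.

(* A quiver on the vertices 'I_n is its skew-symmetric matrix B : there are
   B i j arrows from i to j when B i j > 0. *)
Definition is_quiver (n : nat) (B : 'M[int]_n) : Prop := B^T = - B.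

(* The integer division is exact: |x| * y + x * |y| is 0 or +-2 x y. *)
Definition mutate_quiver (n : nat) (k : 'I_n) (B : 'M[int]_n) : 'M[int]_n :=
  \matrix_(i, j)
    if (i == k) || (j == k) then - B i j
    else B i j + ((`|B i k| * B k j + B i k * `|B k j|) %/ 2)%Z.

(* The entries of a companion are integers because |A i j| = |B i j|, so
   nothing is lost by taking integer matrices. *)
Definition quasi_Cartan_companion (n : nat) (B A : 'M[int]_n) : Prop :=
  [/\ A^T = A,
      forall i, A i i = 2
    & forall i j, i != j -> `|A i j| = `|B i j| ].

Definition mutate_companion (n : nat) (k : 'I_n) (B A : 'M[int]_n) :
    'M[int]_n :=
  \matrix_(i, j)
    if i == j then 2
    else if j == k then Num.sg (B i k) * A i k
    else if i == k then Num.sg (B j k) * A j k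
    else A i j - Num.sg (A i k * A k j) * Num.max (B i k * B k j) 0.

Definition mutate (n : nat) (BA : 'M[int]_n * 'M[int]_n) (k : 'I_n) :
    'M[int]_n * 'M[int]_n :=
  (mutate_quiver k BA.1, mutate_companion k BA.1 BA.2).

Definition mutate_seq (n : nat) (BA : 'M[int]_n * 'M[int]_n)
    (ks : seq 'I_n) : 'M[int]_n * 'M[int]_n :=
  foldl (@mutate n) BA ks.

Definition symmetric_twin (n : nat) (B A : 'M[int]_n) : Prop :=
  quasi_Cartan_companion B A /\
  forall ks : seq 'I_n,
    let BA := mutate_seq (B, A) ks in quasi_Cartan_companion BA.1 BA.2.

(* Triangulated surfaces, given by the triangles into which the arcs cut them
   and the way the sides of these triangles are glued.

   There are m triangles, each with the orientation of the surface; (t, k) is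
   the k-th side of the triangle t, and the sides 0, 1, 2 of a triangle follow
   each other counter-clockwise along its boundary. The sides are directed
   accordingly: the end of a side is the start of the next one. There are n
   arcs; T s = Some i means that the side s lies on the arc i, and T s = None
   that s is a boundary segment of the surface. The surface is obtained by
   gluing, for each arc, the two sides that lie on it, with opposite
   directions, so that the result is oriented. *)
Definition side (m : nat) : finType := ('I_m * 'I_3)%type.

Definition next_side (m : nat) (s : side m) : side m := (s.1, ordS s.2).

Definition glued (m n : nat) (T : side m -> option 'I_n) : rel (side m) :=
  fun s s' => [&& s != s', T s != None & T s == T s'].

Definition adjacent (m n : nat) (T : side m -> option 'I_n) : rel 'I_m :=
  fun t t' => [exists k, exists k', glued T (t, k) (t', k')].

(* A side s also stands for the corner of its triangle at which s starts. If s
   and s' are glued then s starts where s' ends, i.e. where next_side s'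
   starts. The marked points of the surface are the classes of corners for the
   equivalence relation same_point generated by these identifications. *)
Definition corner_glued (m n : nat) (T : side m -> option 'I_n) :
    rel (side m) :=
  fun c c' => [exists s', glued T c s' && (c' == next_side s')].

Definition same_point (m n : nat) (T : side m -> option 'I_n) :
    rel (side m) :=
  connect (fun c c' => corner_glued T c c' || corner_glued T c' c).

Definition on_boundary (m n : nat) (T : side m -> option 'I_n)
    (c : side m) : bool :=
  [exists s, (T s == None) &&
             (same_point T c s || same_point T c (next_side s))].

(* T is a triangulation with at least one arc of a connected surface all of
   whose marked points lie on the boundary. The boundary is then not empty, and
   each boundary component, being a union of sides, contains a marked point.
   Self-folded triangles are excluded by the last condition: two consecutive
   sides of a triangle that are glued enclose a marked point in the interior.
   Conversely the arcs of such a T are automatically essential and pairwise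
   non-isotopic, as a disc with at most two marked points, all of them on its
   boundary, cannot be cut into triangles. *)
Definition unpunctured_triangulation (m n : nat) (T : side m -> option 'I_n) :
    Prop :=
  [/\ (0 < n)%N,
      forall i : 'I_n, #|[set s | T s == Some i]| = 2%N,
      forall t t' : 'I_m, connect (adjacent T) t t'
    & forall c : side m, on_boundary T c].

(* In each triangle there is one arrow from each side to the next one, as long
   as both are arcs. *)
Definition arrows (m n : nat) (T : side m -> option 'I_n) (i j : 'I_n) : nat :=
  #|[set s | (T s == Some i) && (T (next_side s) == Some j)]|.

Definition quiver_of_triangulation (m n : nat) (T : side m -> option 'I_n) :
    'M[int]_n :=
  \matrix_(i, j) ((arrows T i j)%:Z - (arrows T j i)%:Z).

Lemma quiver_of_triangulationP (m n : nat) (T : side m -> option 'I_n) :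
  is_quiver (quiver_of_triangulation T).
Proof. by apply/matrixP=> i j; rewrite !mxE opprB. Qed.

(* Main.v *)
Require Import Defs.
From mathcomp Require Import all_boot all_order all_algebra.
From mathcomp Require Import zify ring.
Set Implicit Arguments.
Unset Strict Implicit.
Unset Printing Implicit Defensive.
Import Order.TTheory GRing.Theory Num.Theory.
Local Open Scope ring_scope.

(** Uniqueness holds for every quiver B. Two twins A and A' are compared
    through the signs of A i j * A' i j on the edges of B: the twins differ by a
    sign change of rows and columns as soon as these signs multiply to 1 along
    every closed walk ([potential]). If B has a path i -> k -> j, then A and its
    mutation at k can both be companions only if the signs of the entry (i, j),
    before and after the mutation, are determined by those of (i, k) and (k, j)
    ([companion_sign]). So triangles have product 1, and the mutation at k
    replaces the two steps i, k, j of a walk by one step with the same sign. A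
    closed walk of length at least 4 is cut by a chord into two shorter ones,
    or it has none near three consecutive steps; then it is shortened by a
    mutation at a vertex that it traverses along the arrows. If two consecutive
    vertices are a source and a sink of the walk, mutating at the first one
    reverses its two arrows, after which the walk traverses the second one along
    the arrows ([closed_walk]).

    For existence, orient the dual graph of the triangulation and send the arc i
    between the triangles t and t' to the vector e_t - e_t'. The twin is the
    Gram matrix of these vectors: up to the diagonal, A i j is the sum, over the
    pairs of a side on i and a side on j in a common triangle, of the product of
    two signs attached to the sides, where glued sides carry opposite signs. The
    flip of an arc k is the reflection in its vector, which exchanges the two
    coordinates of the triangles at k, applied to half of the neighbours of k;
    and this is also what the mutation of companions does. One has to see that
    the terms of B i j do not cancel, that those of A i j do not either, and
    that hence |A i j| = |B i j|. Two opposite arrows could only come from two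
    consecutive sides of the quadrilateral around an arc that are glued, and such
    sides enclose a puncture ([partner_aligned]). That there are no punctures is
    expressed by a rank on the corners that decreases along the rotation around
    every marked point; a flip inserts two new corners, whose ranks can be
    interpolated ([flip_ribbon]). The mutation rules hold for single sides
    ([flip_arrow]) and, as nothing cancels, can be summed over the sides of each
    arc ([mutate_ribbon_quiver], [mutate_ribbon_companion]). *)

(** * Signs and matrix mutation *)

Lemma sg_mul_norm (x : int) : Num.sg x * `|x| = x.
Proof. by rewrite -numEsg. Qed.

Lemma sgM_sq (x : int) : x != 0 -> Num.sg x * Num.sg x = 1.
Proof. by move=> x0; rewrite -expr2 sqr_sg x0. Qed.

Lemma sg_pm1 (x : int) : x != 0 -> Num.sg x = 1 \/ Num.sg x = -1.
Proof. by case: sgrP => // _ _; [left | right]. Qed.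

Lemma quiver_correction (x y : int) :
  ((`|x| * y + x * `|y|) %/ 2)%Z = if 0 < x * y then Num.sg x * (x * y) else 0.
Proof.
case: (sgrP x) => [->|x0|x0]; case: (sgrP y) => [->|y0|y0];
  rewrite ?(mul0r, mulr0, normr0, addr0, div0z, ltxx) //.
- rewrite pmulr_rgt0 // y0 mul1r.
  by have -> : x * y + x * y = x * y * 2 by [ring]; rewrite mulzK.
- by rewrite pmulr_rgt0 // (lt_gtF y0) mulrN addrN div0z.
- by rewrite nmulr_rgt0 // (lt_gtF y0) mulNr addNr div0z.
rewrite nmulr_rgt0 // y0 mulN1r.
by have -> : - x * y + x * - y = - (x * y) * 2 by [ring]; rewrite mulzK.
Qed.

Lemma quiver_correction_double (x y : int) :
  ((`|x| * y + x * `|y|) %/ 2)%Z * 2 = `|x| * y + x * `|y|.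
Proof.
rewrite quiver_correction.
have [x0|x0|->] := ltrgt0P x; have [y0|y0|->] := ltrgt0P y;
  rewrite ?sgr0; try rewrite (gtr0_sg x0); try rewrite (ltr0_sg x0);
  rewrite ?(mulr0, mul0r, mulrN, oppr0, ltxx) //; case: ifP; nia.
Qed.

Lemma sq_unit (d : int) : d * d = 1 -> d = 1 \/ d = -1.
Proof. by move/eqP; rewrite -expr2 sqrf_eq1 => /orP[]/eqP->; [left | right]. Qed.

Lemma companion_correction_double (s t P : int) :
  s * s = 1 -> t * t = 1 -> 0 <= P ->
  Num.sg (s * P) * Num.max (- (t * P)) 0 * 2 = s * P - t * s * P.
Proof.
move=> /sq_unit s1 /sq_unit t1; rewrite le0r => /orP[/eqP->|P0].
  by rewrite !mulr0.
have nP : - P <= 0 by rewrite oppr_le0 ltW.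
rewrite sgrM (gtr0_sg P0) mulr1; case: t1 => ->.
  by rewrite !mul1r (max_idPr nP) mulr0 mul0r subrr.
rewrite mulN1r opprK (max_idPl (ltW P0)).
by case: s1 => ->; rewrite ?sgrN sgr1; ring.
Qed.

Section Mutation.
Variables (n : nat) (k : 'I_n) (B A : 'M[int]_n).

Lemma mutate_quiver_off i j : i != k -> j != k ->
  mutate_quiver k B i j =
    B i j + if 0 < B i k * B k j then Num.sg (B i k) * (B i k * B k j) else 0.
Proof.
by move=> /negbTE ik /negbTE jk; rewrite mxE ik jk /= quiver_correction.
Qed.

Lemma mutate_quiver_at i j : (i == k) || (j == k) ->
  mutate_quiver k B i j = - B i j.
Proof. by rewrite mxE => ->. Qed.

Lemma mutate_companion_off i j : i != j -> i != k -> j != k ->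
  mutate_companion k B A i j =
    A i j - Num.sg (A i k * A k j) * Num.max (B i k * B k j) 0.
Proof.
by move=> /negbTE ij /negbTE ik /negbTE jk; rewrite mxE ij ik jk.
Qed.

Lemma mutate_quiver_skew : is_quiver B -> is_quiver (mutate_quiver k B).
Proof.
move=> hB; have sB i j : B j i = - B i j.
  by move/matrixP: hB => /(_ i j); rewrite !mxE.
apply/matrixP=> i j; rewrite !mxE orbC (sB i j).
case: ifP => // _; rewrite (sB k j) (sB i k) !normrN.
have := quiver_correction_double (B k j) (- B i k).
have := quiver_correction_double (B i k) (B k j).
rewrite normrN; move: (_ %/ 2)%Z => u; move: (_ %/ 2)%Z => v.
lia.
Qed.

End Mutation.

(** The alternative a = s * d * b gives |b - d * p| = |b + d * p|, which forces
    b = 0. *)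
Lemma sign_of_correction (a b s d p : int) :
  s = 1 \/ s = -1 -> d = 1 \/ d = -1 -> 0 < p ->
  `|a| = `|b| -> `|a - s * p| = `|b + d * p| -> a = - s * d * b.
Proof. by case=> ->; case=> ->; lia. Qed.

Section CompanionStep.
Variables (n : nat) (k : 'I_n) (B A : 'M[int]_n).
Hypotheses (hA : quasi_Cartan_companion B A)
  (hA' : quasi_Cartan_companion (mutate_quiver k B) (mutate_companion k B A)).

Lemma companion_eq0 i j : i != j -> (A i j == 0) = (B i j == 0).
Proof.
by move=> ij; case: hA => _ _ /(_ i j ij) e; rewrite -normr_eq0 e normr_eq0.
Qed.

(** For i -> k -> j, or the reverse path, the same sign relates A to B at (i, j)
    before and after the mutation, and it depends only on the entries of A in
    column k. When B i j = 0 the second equation fixes the sign of the new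
    entry; otherwise the first one fixes the sign of the old one. *)
Lemma companion_sign i j : i != j -> i != k -> j != k -> 0 < B i k * B k j ->
  let u := - Num.sg (A i k * A k j) * Num.sg (B i k) in
  A i j = u * B i j /\ mutate_companion k B A i j = u * mutate_quiver k B i j.
Proof.
move=> ij ik jk p0; case: hA hA' => _ _ eqA [_ _ eqA'] /=.
have [bik bkj] : B i k != 0 /\ B k j != 0.
  by move: (negbT (gt_eqF p0)); rewrite mulf_eq0 negb_or => /andP[].
have kj : k != j by rewrite eq_sym.
have sA : Num.sg (A i k * A k j) = 1 \/ Num.sg (A i k * A k j) = -1.
  by apply: sg_pm1; rewrite mulf_neq0 // companion_eq0.
have sB := sg_pm1 bik.
have := eqA' i j ij; rewrite mutate_quiver_off // mutate_companion_off // p0.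
rewrite (max_idPl (ltW p0)) => e.
have -> := sign_of_correction sA sB p0 (eqA i j ij) e.
split=> //; move: sA sB; set s := Num.sg _; set d := Num.sg _.
by case=> ->; case=> ->; ring.
Qed.

End CompanionStep.

(** * Signs along walks *)

Section Weight.
Variables (V : finType) (R : V -> V -> int).

Fixpoint weight (x : V) (p : seq V) : int :=
  if p is y :: p' then R x y * weight y p' else 1.

Lemma weight_cat x p q : weight x (p ++ q) = weight x p * weight (last x p) q.
Proof. by elim: p x => [|y p IH] x /=; rewrite ?mul1r // IH mulrA. Qed.

Lemma weight_rcons x p y : weight x (rcons p y) = weight x p * R (last x p) y.
Proof. by rewrite -cats1 weight_cat /= mulr1. Qed.

(** A chord from the end of p2 to its start cuts a closed walk in two, as the
    chord is run through twice, in opposite directions. *)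
Lemma weight_chord x p1 p2 p3 :
  let v := last x p1 in let u := last v p2 in R v u * R u v = 1 ->
  weight x (p1 ++ p2 ++ p3) = weight v (rcons p2 v) * weight x (p1 ++ u :: p3).
Proof.
move=> v u vu; rewrite !weight_cat weight_rcons /= -/v -/u.
have -> : weight v p2 * R u v * (weight x p1 * (R v u * weight u p3)) =
  (R v u * R u v) * (weight x p1 * (weight v p2 * weight u p3)) by ring.
by rewrite vu mul1r.
Qed.

Lemma last_rev_belast (x : V) p : last (last x p) (rev (belast x p)) = x.
Proof. by case: p => [|y p] //=; rewrite rev_cons last_rcons. Qed.

Lemma weight_rev x p : (forall a b, R a b = R b a) ->
  weight (last x p) (rev (belast x p)) = weight x p.
Proof.
move=> sR; elim: p x => [|y p IH] x //=.
by rewrite rev_cons weight_rcons IH mulrC last_rev_belast (sR y).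
Qed.

Variable e : rel V.
Hypotheses (e_sym : symmetric e) (R_sym : forall a b, R a b = R b a)
  (R_sq : forall a b, e a b -> R a b * R a b = 1)
  (closedR : forall x p, path e x p -> last x p = x -> weight x p = 1).

Lemma weight_sq x p : path e x p -> weight x p * weight x p = 1.
Proof.
elim: p x => [|y p IH] x //= /andP[/R_sq Rxy /IH].
have -> : R x y * weight y p * (R x y * weight y p) =
  (R x y * R x y) * (weight y p * weight y p) by ring.
by rewrite Rxy => ->.
Qed.

(** The value at i is the weight of a path to i from the representative of its
    component; closed walks of weight 1 make it independent of the path. *)
Lemma potential : exists eps : V -> int,
  (forall i, eps i = 1 \/ eps i = -1) /\
  (forall i j, e i j -> R i j = eps i * eps j).
Proof.
have cs : connect_sym e := sym_connect_sym e_sym.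
have /fin_all_exists[p pP] : forall i : V, exists p : seq V,
    path e (fingraph.root e i) p /\ last (fingraph.root e i) p = i.
  move=> i; have /connectP[p ep ei] : connect e (fingraph.root e i) i.
    by rewrite cs connect_root.
  by exists p.
exists (fun i => weight (fingraph.root e i) (p i)); split=> [i|i j eij].
  have [ep _] := pP i; move: (weight_sq ep).
  by move: (weight _ _) => w /eqP; rewrite -expr2 sqrf_eq1 => /orP[]/eqP->;
    [left | right].
have [ei li] := pP i; have [ej lj] := pP j.
have rij : fingraph.root e j = fingraph.root e i.
  by apply/esym/eqP; rewrite (root_connect cs) connect1.
rewrite rij in ej lj *.
set r := fingraph.root e i in ei li ej lj *.
have := closedR (x := r) (p := p i ++ j :: rev (belast r (p j))).
rewrite cat_path /= li eij ei /= last_cat /=.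
have -> : path e j (rev (belast r (p j))).
  by rewrite -[j in path _ j]lj rev_path (eq_path (e' := e)).
have -> : last j (rev (belast r (p j))) = r.
  by rewrite -[j in last j _]lj last_rev_belast.
move=> /(_ isT erefl); rewrite weight_cat /= li.
have := weight_rev r (p j) R_sym; rewrite lj => ->.
set u := weight r (p i); set v := weight r (p j) => h.
have uu : u * u = 1 := weight_sq ei; have vv : v * v = 1 := weight_sq ej.
rewrite -[R i j]mulr1 -{1}uu -[R i j * _]mulr1 -{1}vv -[RHS]mul1r -h; ring.
Qed.

End Weight.

(** * Uniqueness of the twin *)

(** The relation is reflexive, so that walks may pause: coincidences between the
    vertices of a walk then count as chords. *)
Definition adj (n : nat) (B : 'M[int]_n) : rel 'I_n :=
  fun i j => (i == j) || (B i j != 0).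

Definition ratio (n : nat) (A A' : 'M[int]_n) (i j : 'I_n) : int :=
  Num.sg (A i j * A' i j).

Lemma twin_companion (n : nat) (B A : 'M[int]_n) :
  symmetric_twin B A -> quasi_Cartan_companion B A.
Proof. by case. Qed.

Lemma twin_mutate (n : nat) (k : 'I_n) (B A : 'M[int]_n) :
  symmetric_twin B A ->
  symmetric_twin (mutate_quiver k B) (mutate_companion k B A).
Proof. by case=> _ h; split=> [|ks]; [exact: (h [:: k]) | exact: (h (k :: ks))]. Qed.

Section TwinPair.
Variables (n : nat) (B A A' : 'M[int]_n).
Hypotheses (hB : is_quiver B) (hA : symmetric_twin B A)
  (hA' : symmetric_twin B A').

Lemma quiver_opp i j : B j i = - B i j.
Proof. by move/matrixP: hB => /(_ i j); rewrite !mxE. Qed.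

Lemma quiver_diag i : B i i = 0.
Proof. by have := quiver_opp i i; lia. Qed.

Lemma adj_sym : symmetric (adj B).
Proof. by move=> i j; rewrite /adj eq_sym quiver_opp oppr_eq0. Qed.

Lemma adj_refl i : adj B i i.
Proof. by rewrite /adj eqxx. Qed.

Lemma companion_sym (C : 'M[int]_n) i j :
  quasi_Cartan_companion B C -> C i j = C j i.
Proof. by case=> sC _ _; rewrite -[in LHS]sC mxE. Qed.

Lemma companion_adj (C : 'M[int]_n) i j :
  quasi_Cartan_companion B C -> (C i j != 0) = adj B i j.
Proof.
move=> hC; rewrite /adj; case: (eqVneq i j) => [->|ij];
  last by rewrite (companion_eq0 hC).
by have [_ h2 _] := hC; rewrite h2.
Qed.

Lemma ratio_sym i j : ratio A A' i j = ratio A A' j i.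
Proof.
rewrite /ratio (companion_sym i j (twin_companion hA)).
by rewrite (companion_sym i j (twin_companion hA')).
Qed.

Lemma ratio_sq i j : adj B i j -> ratio A A' i j * ratio A A' i j = 1.
Proof.
move=> hij; apply: sgM_sq.
by rewrite mulf_neq0 // companion_adj //; exact: twin_companion.
Qed.

Lemma ratio_back i j : adj B i j -> ratio A A' i j * ratio A A' j i = 1.
Proof. by move=> /ratio_sq; rewrite (ratio_sym j i). Qed.

Lemma ratio_diag i : ratio A A' i i = 1.
Proof.
have [_ dA _] := twin_companion hA; have [_ dA' _] := twin_companion hA'.
by rewrite /ratio dA dA'.
Qed.

(** The common sign in [companion_sign] cancels between A and A' up to the
    entries of column k. *)
Lemma ratio_step i j k : i != j -> 0 < B i k * B k j ->
  (adj B i j -> ratio A A' i j = ratio A A' i k * ratio A A' k j) /\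
  (adj (mutate_quiver k B) i j ->
   ratio (mutate_companion k B A) (mutate_companion k B A') i j =
   ratio A A' i k * ratio A A' k j).
Proof.
move=> ij p0.
have ik : i != k by apply: contraTneq p0 => ->; rewrite quiver_diag mul0r ltxx.
have jk : j != k by apply: contraTneq p0 => ->; rewrite quiver_diag mulr0 ltxx.
have [h1 h2] := companion_sign (twin_companion hA)
  (twin_companion (twin_mutate k hA)) ij ik jk p0.
have [h1' h2'] := companion_sign (twin_companion hA')
  (twin_companion (twin_mutate k hA')) ij ik jk p0.
have bik : B i k != 0 by apply: contraTneq p0 => ->; rewrite mul0r ltxx.
rewrite /adj (negbTE ij) /= /ratio h1 h2 h1' h2'.
have key (b : int) : b != 0 ->
    Num.sg (- Num.sg (A i k * A k j) * Num.sg (B i k) * b *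
            (- Num.sg (A' i k * A' k j) * Num.sg (B i k) * b)) =
    Num.sg (A i k * A' i k) * Num.sg (A k j * A' k j).
  move=> b0; rewrite !(sgrM, sgrN, sgr_id).
  have := sgM_sq b0; have := sgM_sq bik.
  move: (Num.sg _) (Num.sg b) => u v uu vv.
  set s1 := Num.sg (A i k); set s2 := Num.sg (A k j).
  set t1 := Num.sg (A' i k); set t2 := Num.sg (A' k j).
  transitivity ((u * u) * (v * v) * (s1 * t1 * (s2 * t2))); first by ring.
  by rewrite uu vv !mul1r.
by split; apply: key.
Qed.

(** Among the three vertices of a triangle, one at least is traversed along the
    arrows. *)
Lemma weight_triangle i j k : adj B i j -> adj B j k -> adj B k i ->
  ratio A A' i j * (ratio A A' j k * ratio A A' k i) = 1.
Proof.
move=> eij ejk eki.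
case: (eqVneq i j) (eij) => [<-|ij bij].
  by rewrite ratio_diag mul1r ratio_back // adj_sym.
case: (eqVneq j k) (ejk) => [<-|jk bjk].
  by rewrite ratio_diag mul1r ratio_back.
case: (eqVneq k i) (eki) => [->|ki bki].
  by rewrite ratio_diag mulr1 ratio_back.
move: bij bjk bki; rewrite /adj (negbTE ij) (negbTE jk) (negbTE ki) /=.
move=> bij bjk bki.
have key u v w : u != w -> adj B w u -> 0 < B u v * B v w ->
    ratio A A' u v * (ratio A A' v w * ratio A A' w u) = 1.
  move=> uw ewu p0; have [+ _] := ratio_step uw p0.
  by rewrite adj_sym => /(_ ewu) E; rewrite mulrA -E ratio_back // adj_sym.
have : [|| 0 < B i j * B j k, 0 < B j k * B k i | 0 < B k i * B i j].
  by move: bij bjk bki; case: (ltrgt0P (B i j)) => // h1 _;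
     case: (ltrgt0P (B j k)) => // h2 _; case: (ltrgt0P (B k i)) => // h3 _;
     nia.
case/or3P=> p0.
- by apply: key p0 => //; rewrite eq_sym.
- by rewrite mulrC -mulrA; apply: key p0 => //; rewrite eq_sym.
by rewrite mulrA mulrC; apply: key p0 => //; rewrite eq_sym.
Qed.

Section Step.
Variable k : 'I_n.
Let B1 := mutate_quiver k B.
Let A1 := mutate_companion k B A.
Let A1' := mutate_companion k B A'.

Lemma adj_step i j : B i k * B k j <= 0 -> adj B1 i j = adj B i j.
Proof.
move=> le0; rewrite /adj; case: (boolP ((i == k) || (j == k))) => [ijk|].
  by rewrite mutate_quiver_at // oppr_eq0.
by rewrite negb_or => /andP[ik jk]; rewrite mutate_quiver_off // ltNge le0 addr0.
Qed.

(** A mutation at k affects the entry (i, j) only if k lies between i and j on a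
    directed path; in column k it multiplies A and A' by the same signs. *)
Lemma ratio_unchanged i j : B i k * B k j <= 0 ->
  ratio A1 A1' i j = ratio A A' i j.
Proof.
move=> le0; case: (eqVneq i j) => [->|ij].
  by rewrite /ratio !mxE eqxx; have [_ -> _] := twin_companion hA;
     have [_ -> _] := twin_companion hA'.
have sgsq (a a' b : int) : (b == 0 -> a == 0) ->
    Num.sg (Num.sg b * a * (Num.sg b * a')) = Num.sg (a * a').
  case: (eqVneq b 0) => [_ /(_ isT)/eqP->|b0 _]; first by rewrite !(mul0r, mulr0).
  by rewrite mulrACA sgM_sq ?sgr_id // mul1r.
have b0 u v : u != v -> B u v == 0 -> A u v == 0.
  by move=> uv; rewrite (companion_eq0 (twin_companion hA)).
case: (eqVneq j k) (ij) => [->|jk] ik.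
  by rewrite /ratio !mxE (negbTE ik) eqxx sgsq //; apply: b0.
case: (eqVneq i k) (ij) => [->|ik'] jk'.
  rewrite ratio_sym /ratio !mxE (negbTE jk') (negbTE jk) eqxx sgsq //.
  by apply: b0.
by rewrite /ratio /A1 /A1' !mutate_companion_off // (max_idPr le0) !mulr0 !subr0.
Qed.

Lemma path_step (x : 'I_n) p :
  path (fun i j => B i k * B k j <= 0) x p -> path (adj B) x p ->
  path (adj B1) x p /\ weight (ratio A1 A1') x p = weight (ratio A A') x p.
Proof.
elim: p x => [|y p IH] x //= /andP[xy /IH{}IH] /andP[exy /IH[-> ->]].
by rewrite adj_step // exy ratio_unchanged.
Qed.

(** The return path may end anywhere: its last step starts at a vertex that is
    not adjacent to k. *)
Lemma path_far (w : 'I_n) q x : all (fun u => B k u == 0) (w :: q) ->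
  path (fun i j => B i k * B k j <= 0) w (rcons q x).
Proof.
have far u : B k u == 0 -> B u k = 0 by rewrite quiver_opp => /eqP; lia.
elim: q w => [|v q IH] w /=; first by rewrite andbT => /far->; rewrite mul0r lexx.
by move=> /and3P[/far-> kv kq]; rewrite mul0r lexx IH //= kv.
Qed.

End Step.

Lemma nonadj_eq0 k q : all (fun u => ~~ adj B k u) q ->
  all (fun u => B k u == 0) q.
Proof.
by apply: sub_all => u; rewrite negb_or negbK => /andP[].
Qed.

End TwinPair.

(** All quivers of a given size are treated at once, because walks are shortened
    by mutations. *)
Definition closed_below (n L : nat) := forall (B A A' : 'M[int]_n),
  is_quiver B -> symmetric_twin B A -> symmetric_twin B A' ->
  forall x p, path (adj B) x p -> last x p = x -> (size p <= L)%N ->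
  weight (ratio A A') x p = 1.

(** Mutating at y creates the edge from x to z, which replaces the two steps
    through y, and leaves the rest of the walk unchanged, since y is adjacent to
    no further vertex. *)
Lemma shorten (n L : nat) (B A A' : 'M[int]_n) x y z (q : seq 'I_n) :
  closed_below n L -> is_quiver B ->
  symmetric_twin B A -> symmetric_twin B A' ->
  (size q + 2 <= L)%N -> path (adj B) x [:: y, z & rcons q x] ->
  0 < B x y * B y z -> ~~ adj B x z -> all (fun u => ~~ adj B y u) q ->
  weight (ratio A A') x [:: y, z & rcons q x] = 1.
Proof.
move=> IH hB hA hA' szq /= /and3P[exy eyz ezq] p0 nxz farq.
have xz : x != z by apply: contraNneq nxz => ->; rewrite adj_refl.
have bxz : B x z = 0.
  by move: nxz; rewrite /adj (negbTE xz) /= negbK => /eqP.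
have xy : x != y.
  by apply: contraTneq p0 => ->; rewrite quiver_diag // mul0r ltxx.
have zy : z != y.
  by apply: contraTneq p0 => ->; rewrite quiver_diag // mulr0 ltxx.
have exz : adj (mutate_quiver y B) x z.
  rewrite /adj (negbTE xz) mutate_quiver_off // p0 bxz add0r.
  apply: mulf_neq0; last by rewrite gt_eqF.
  by rewrite sgr_eq0; apply: contraTneq p0 => ->; rewrite mul0r ltxx.
have [_ /(_ exz) Rxz] := ratio_step hB hA hA' xz p0.
have [pq wq] : path (adj (mutate_quiver y B)) z (rcons q x) /\
    weight (ratio (mutate_companion y B A) (mutate_companion y B A')) z (rcons q x)
    = weight (ratio A A') z (rcons q x).
  case: q ezq farq {szq} => [|w q] ezq farq.
    by move: ezq; rewrite /= andbT adj_sym // (negbTE nxz).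
  apply: path_step => //=; have /= /andP[yw yq] := nonadj_eq0 farq.
  by rewrite (eqP yw) mulr0 lexx path_far //= yw.
have /= := IH _ _ _ (mutate_quiver_skew y hB) (twin_mutate y hA)
  (twin_mutate y hA') x (z :: rcons q x).
rewrite exz pq last_rcons size_rcons wq Rxz mulrA => -> //.
by rewrite addn2 in szq.
Qed.

(** Only chords at the second and third vertices y and z are considered. Without
    them the walk can be shortened at y, at z, or at z after a mutation at y. *)
Lemma closed_walk (n L : nat) : closed_below n L.
Proof.
elim: L => [|L IH] B A A' hB hA hA' x p.
  by case: p.
have chord p1 p2 p3 : path (adj B) x (p1 ++ p2 ++ p3) ->
    last x (p1 ++ p2 ++ p3) = x -> (size p2 < L)%N ->
    (size p1 + size p3 < L)%N -> adj B (last x p1) (last (last x p1) p2) ->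
    weight (ratio A A') x (p1 ++ p2 ++ p3) = 1.
  rewrite !cat_path !last_cat; set v := last x p1; set u := last v p2.
  move=> /and3P[e1 e2 e3] lx s2 s13 vu.
  have uv : adj B u v by rewrite adj_sym.
  rewrite (weight_chord p3 (ratio_back hA hA' vu)) -/v -/u.
  have -> : weight (ratio A A') v (rcons p2 v) = 1.
    apply: (IH B A A') => //; rewrite ?last_rcons ?size_rcons //.
    by rewrite rcons_path e2.
  rewrite mul1r; apply: (IH B A A') => //; rewrite ?last_cat //.
    by rewrite cat_path e1 /= vu.
  by rewrite size_cat /= addnS.
have triangle y z : path (adj B) x [:: y; z; x] ->
    weight (ratio A A') x [:: y; z; x] = 1.
  by rewrite /= andbT mulr1 => /and3P[? ? ?]; apply: (weight_triangle hB hA hA').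
case: p => [|y [|z p]] //=.
  by rewrite andbT mulr1 => _ -> _; exact: ratio_diag hA hA' _.
case: (lastP p) => [|q x'] /=.
  move=> /and3P[exy _ _] zx _; rewrite zx mulr1 in exy *.
  exact: (ratio_back hA hA' exy).
rewrite last_rcons size_rcons => + xx'; rewrite {x'}xx' => ep szq.
case: q ep szq => [|w q] ep szq; first exact: triangle.
rewrite -![_ * (_ * _)]/(weight (ratio A A') x [:: y, z & rcons (w :: q) x]).
rewrite -[_ && _]/(path (adj B) x [:: y, z & rcons (w :: q) x]) in ep.
have [exz|nxz] := boolP (adj B x z).
  apply: (chord [::] [:: y; z] (rcons (w :: q) x)) => //=.
  - by rewrite last_rcons.
  - by move: szq; rewrite /=; lia.
  by move: szq; rewrite /= size_rcons; lia.
have [/hasP[u /splitPr uq yu]|] := boolP (has (adj B y) (w :: q)).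
  case: uq ep szq => q1 q2 ep szq.
  have E : [:: y, z & rcons (q1 ++ u :: q2) x] =
      [:: y] ++ (z :: rcons q1 u) ++ rcons q2 x.
    by rewrite rcons_cat /= cat_rcons.
  move: ep szq; rewrite E size_cat => ep szq; rewrite /= in szq.
  apply: (chord [:: y] (z :: rcons q1 u) (rcons q2 x) ep);
    rewrite /= ?last_cat ?last_rcons ?size_rcons //; lia.
rewrite -all_predC => far_y.
have [/hasP[u /splitPr uq zu]|] := boolP (has (adj B z) q).
  case: uq ep szq {far_y} => q1 q2 ep szq.
  have E : [:: y, z & rcons (w :: q1 ++ u :: q2) x] =
      [:: y; z] ++ (w :: rcons q1 u) ++ rcons q2 x.
    by rewrite /= rcons_cat /= cat_rcons.
  move: ep szq; rewrite E /= size_cat => ep szq; rewrite /= in szq.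
  apply: (chord [:: y; z] (w :: rcons q1 u) (rcons q2 x) ep);
    rewrite /= ?last_cat ?last_rcons ?size_rcons //; lia.
rewrite -all_predC => far_z.
have ep0 := ep; rewrite /= in ep0; case/and4P: ep0 => exy eyz ezw eq.
have xy : x != y by apply: contraNneq nxz => ->.
have yz : y != z by apply: contraNneq nxz => <-.
have yw : ~~ adj B y w by case/andP: far_y.
have zw : z != w by apply: contraNneq yw => <-.
have bxy : B x y != 0 by move: exy; rewrite /adj (negbTE xy).
have byz : B y z != 0 by move: eyz; rewrite /adj (negbTE yz).
have bzw : B z w != 0 by move: ezw; rewrite /adj (negbTE zw).
have size_q : (size (w :: q) + 2 <= L)%N.
  by rewrite /= addn2.
have [p1|p1] := ltP 0 (B x y * B y z).
  (* y is traversed along the arrows *)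
  exact: (shorten IH hB hA hA' size_q ep p1 nxz far_y).
(* To shorten at z, the walk is read from its second vertex. *)
have turn (C : 'I_n -> 'I_n -> int) : weight C x [:: y, z & rcons (w :: q) x]
    = weight C y [:: z, w & rcons (rcons q x) y].
  by rewrite /= !weight_rcons last_rcons; ring.
have turn_path (e : rel 'I_n) : path e x [:: y, z & rcons (w :: q) x]
    = path e y [:: z, w & rcons (rcons q x) y].
  by rewrite /= !rcons_path last_rcons /= andbC !andbA.
have size_q' : (size (rcons q x) + 2 <= L)%N by rewrite size_rcons.
have far_zx : all (fun u => ~~ adj B z u) (rcons q x).
  by rewrite all_rcons adj_sym // nxz.
have [p2|p2] := ltP 0 (B y z * B z w).
  by rewrite turn (shorten IH hB hA hA' size_q') // -turn_path.
(* Now y and z are a source and a sink of the walk. Mutating at y reverses the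
   arrows at y only, and then z is traversed along the arrows. *)
have far0 := nonadj_eq0 far_y.
have [ep1 <-] : path (adj (mutate_quiver y B)) x [:: y, z & rcons (w :: q) x] /\
  weight (ratio (mutate_companion y B A) (mutate_companion y B A')) x
    [:: y, z & rcons (w :: q) x] =
  weight (ratio A A') x [:: y, z & rcons (w :: q) x].
  apply: path_step => //=.
  have /andP[/eqP bw _] := far0.
  rewrite !quiver_diag // bw !(mulr0, mul0r) lexx /=.
  exact: path_far.
rewrite turn (shorten IH (mutate_quiver_skew y hB) (twin_mutate y hA)
  (twin_mutate y hA') size_q') // -?turn_path //.
- rewrite mutate_quiver_at ?eqxx // mutate_quiver_off 1?eq_sym //; last first.
    by apply: contraNneq yw => ->; apply: adj_refl.
  case/andP: far0 => /eqP-> _; rewrite mulr0 ltxx addr0 mulNr oppr_gt0.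
  by rewrite lt_neqAle p2 mulf_neq0.
- by rewrite adj_step // quiver_diag // mul0r.
rewrite all_rcons adj_step // ?nxz' //.
  rewrite adj_sym // nxz /=; apply/allP=> u uq.
  rewrite adj_step //; first by apply: (allP far_z).
  by case/andP: far0 => _ /allP/(_ u uq)/eqP->; rewrite mulr0.
by rewrite (quiver_opp hB y z) (quiver_opp hB x y) mulrNN mulrC.
Qed.

(** The ratio of A and A' is a coboundary by [closed_walk], and the entries of A
    and A' have equal absolute values. *)
Lemma twin_unique (n : nat) (B A A' : 'M[int]_n) : is_quiver B ->
  symmetric_twin B A -> symmetric_twin B A' ->
  exists eps : 'I_n -> int,
    (forall i, eps i = 1 \/ eps i = -1) /\
    (forall i j, A' i j = eps i * eps j * A i j).
Proof.
move=> hB hA hA'.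
have [eps [eps1 epsR]] := potential (adj_sym hB) (ratio_sym hA hA')
  (ratio_sq hA hA') (fun x p ep lp => closed_walk hB hA hA' ep lp (leqnn _)).
exists eps; split=> // i j.
have cA := twin_companion hA; have cA' := twin_companion hA'.
have [eij|nij] := boolP (adj B i j); last first.
  have zero C : quasi_Cartan_companion B C -> C i j = 0.
    by move=> cC; apply: contraNeq nij; rewrite (companion_adj i j cC).
  by rewrite !zero // mulr0.
have nA : `|A i j| = `|A' i j|.
  case: (eqVneq i j) => [<-|ij].
    by have [_ -> _] := cA; have [_ -> _] := cA'.
  by have [_ _ ->] := cA => //; have [_ _ ->] := cA'.
rewrite -epsR // /ratio sgrM.
have -> : Num.sg (A i j) * Num.sg (A' i j) * A i j =
  Num.sg (A' i j) * (Num.sg (A i j) * A i j) by ring.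
by rewrite -normrEsg nA sg_mul_norm.
Qed.

(** * Flips on the level of sides *)

(** The sides of the triangles form a set with a map nx to the next side of the
    same triangle. A flip keeps the sides, their gluing and their signs, and
    changes only nx. *)
Definition follows (S : eqType) (nx : S -> S) (x y : S) : int := (nx x == y)%:R.

Definition arrow (S : eqType) (nx : S -> S) (x y : S) : int :=
  follows nx x y - follows nx y x.

Definition near (S : eqType) (nx : S -> S) (x y : S) : int :=
  follows nx x y + follows nx y x.

Section SixSides.
Variables (S : finType) (nx : S -> S) (k0 k1 : S).
Hypotheses (nx3 : forall x, nx (nx (nx x)) = x) (nx_neq : forall x, nx x != x).
Hypotheses (k10 : k1 != k0) (k1a : k1 != nx k0) (k1b : k1 != nx (nx k0)).

(** The two triangles at the arc with sides k0 and k1. *)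
Definition six_sides : seq S :=
  [:: k0; nx k0; nx (nx k0); k1; nx k1; nx (nx k1)].

Definition six (i : nat) : S := nth k0 six_sides i.

(** The quadrilateral around the arc has the sides 1, 2, 4, 5 of the list, in
    counter-clockwise order. The other diagonal cuts it into the triangles
    (0, 2, 4) and (3, 5, 1), so that the next side is found two places
    further. *)
Definition flip (x : S) : S :=
  if x \in six_sides then six ((index x six_sides + 2) %% 6) else nx x.

Lemma six_uniq : uniq six_sides.
Proof.
move/eqP: k10 => f0; move/eqP: k1a => f1; move/eqP: k1b => f2.
have g0 := nx3 k0; have g1 := nx3 k1.
have /eqP h0 := nx_neq k0; have /eqP h1 := nx_neq k1.
have /eqP h2 := nx_neq (nx k0); have /eqP h3 := nx_neq (nx k1).
rewrite /= !inE !negb_or !andbT -!andbA.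
by do ?[apply/andP; split]; apply/eqP; congruence.
Qed.

Lemma nx_six i : (i < 6)%N ->
  nx (six i) = six (nth 0%N [:: 1; 2; 0; 4; 5; 3] i)%N.
Proof. by case: i => [|[|[|[|[|[|i]]]]]] //= _; rewrite /six /= ?nx3. Qed.

Lemma flip_six i : (i < 6)%N -> flip (six i) = six ((i + 2) %% 6).
Proof. by move=> i6; rewrite /flip mem_nth // index_uniq // six_uniq. Qed.

Lemma six_eq i j : (i < 6)%N -> (j < 6)%N -> (six i == six j) = (i == j).
Proof. by move=> i6 j6; rewrite nth_uniq // six_uniq. Qed.

Lemma sixP x : x \in six_sides -> exists2 i, (i < 6)%N & x = six i.
Proof.
by move=> xh; exists (index x six_sides); rewrite ?index_mem // /six nth_index.
Qed.

Lemma mem_six_nx x : (nx x \in six_sides) = (x \in six_sides).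
Proof.
have up y : y \in six_sides -> nx y \in six_sides.
  case/sixP=> i i6 ->; rewrite nx_six // mem_nth //.
  by do 6! [case: i i6 => [|i] //= i6].
by apply/idP/idP=> [/up/up|/up //]; rewrite nx3.
Qed.

Lemma flip_out x : x \notin six_sides -> flip x = nx x.
Proof. by rewrite /flip => /negbTE->. Qed.

Lemma flip3 x : flip (flip (flip x)) = x.
Proof.
have [/sixP[i i6 ->]|xh] := boolP (x \in six_sides).
  rewrite !flip_six ?ltn_pmod //; congr six.
  by do 6! [case: i i6 => [|i] //= i6].
by rewrite !flip_out ?mem_six_nx ?nx3.
Qed.

Lemma flip_neq x : flip x != x.
Proof.
have [/sixP[i i6 ->]|xh] := boolP (x \in six_sides); last by rewrite flip_out.
rewrite flip_six // six_eq ?ltn_pmod //.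
by do 6! [case: i i6 => [|i] //= i6].
Qed.

Definition arrow_k (nx : S -> S) x : int := arrow nx x k0 + arrow nx x k1.
(** The sum of [near] over both sides of the arc, weighted by their opposite
    signs relative to k0. *)
Definition near_k (nx : S -> S) x : int := near nx x k0 - near nx x k1.

Lemma follows_six i j : (i < 6)%N -> (j < 6)%N ->
  (follows nx (six i) (six j) = (nth 0%N [:: 1; 2; 0; 4; 5; 3] i == j)%:R)
  * (follows flip (six i) (six j) = ((i + 2) %% 6 == j)%:R)%N.
Proof.
move=> i6 j6; have i6' : (nth 0 [:: 1; 2; 0; 4; 5; 3] i < 6)%N.
  by case: i i6 => [|[|[|[|[|[|i]]]]]].
by rewrite /follows nx_six // flip_six // !six_eq ?ltn_pmod.
Qed.

Lemma follows_out x y : x \notin six_sides -> y \in six_sides ->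
  (follows nx x y = 0) * (follows nx y x = 0) *
  (follows flip x y = 0) * (follows flip y x = 0).
Proof.
move=> xh yh; have neq z : z \in six_sides -> (z == x) = false /\ (x == z) = false.
  by move=> zh; split; apply: contraNF xh => /eqP; [move=> <- | move=> ->].
have fh : flip y \in six_sides.
  by case/sixP: yh => i i6 ->; rewrite flip_six // mem_nth // ltn_pmod.
have xh' : (nx x == y) = false.
  by apply: contraNF xh => /eqP xy; rewrite -mem_six_nx xy.
rewrite /follows flip_out // xh' !(neq _ _).1 //.
by rewrite mem_six_nx.
Qed.

Definition outer x := (x != k0) && (x != k1).

Lemma outerP x : outer x ->
  x \notin six_sides \/ exists2 i, i \in [:: 1; 2; 4; 5]%N & x = six i.
Proof.
case/andP=> x0 x1; have [/sixP[i i6 e]|] := boolP (x \in six_sides); last by left.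
right; exists i => //; move: x0 x1 i6; rewrite e.
by case: i {e} => [|[|[|[|[|[|i]]]]]] //=; rewrite eqxx.
Qed.

Lemma six_mem i : i \in [:: 1; 2; 4; 5]%N -> six i \in six_sides.
Proof. by rewrite !inE => /or4P[]/eqP->; rewrite !eqxx ?orbT. Qed.

Lemma outer_six i : i \in [:: 1; 2; 4; 5]%N -> outer (six i).
Proof.
move=> ih; have i6 : (i < 6)%N by move: ih; rewrite !inE => /or4P[]/eqP->.
have e0 : (six i == k0) = (i == 0)%N := six_eq i6 (isT : 0 < 6)%N.
have e1 : (six i == k1) = (i == 3)%N := six_eq i6 (isT : 3 < 6)%N.
by rewrite /outer e0 e1; move: ih; rewrite !inE => /or4P[]/eqP->.
Qed.

Lemma k_six : (k0 = six 0) * (k1 = six 3).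
Proof. by []. Qed.

Let k0h : k0 \in six_sides. Proof. exact: mem_head. Qed.
Let k1h : k1 \in six_sides. Proof. by rewrite !inE eqxx !orbT. Qed.

Lemma arrow_k_out x : x \notin six_sides ->
  (arrow_k nx x = 0) * (near_k nx x = 0) *
  (arrow_k flip x = 0) * (near_k flip x = 0).
Proof.
by move=> xh; rewrite /arrow_k /near_k /arrow /near !(follows_out xh).
Qed.

Lemma six_k i : i \in [:: 1; 2; 4; 5]%N ->
  [/\ arrow_k nx (six i) = (-1) ^+ (i %% 3),
      near_k nx (six i) = (-1) ^+ (i %/ 3),
      arrow_k flip (six i) = - (-1) ^+ (i %% 3)
    & near_k flip (six i) = (-1) ^+ (i %% 3) * (-1) ^+ (i %/ 3)].
Proof.
rewrite !inE /arrow_k /near_k /arrow /near => /or4P[]/eqP->;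
  by rewrite !k_six !follows_six.
Qed.

(** The analogue of the rule for row and column k; as [arrow_k] is 0, 1 or -1 it
    is its own sign. *)
Lemma flip_arrow_k x : outer x ->
  arrow_k flip x = - arrow_k nx x /\ near_k flip x = arrow_k nx x * near_k nx x.
Proof.
case/outerP=> [xh|[i ih ->]]; first by rewrite !arrow_k_out.
by have [-> -> -> ->] := six_k ih.
Qed.

(** Single sides obey the mutation rules of quivers and of companions. The
    factor 2 clears the denominator; in the second rule, the last factor selects
    the pairs of sides with arrows from x to k and from k to y, or the
    reverse. *)
Lemma flip_arrow x y : outer x -> outer y ->
  arrow flip x y * 2 = arrow nx x y * 2 +
    (`|arrow_k nx x| * - arrow_k nx y + arrow_k nx x * `|arrow_k nx y|) /\
  near flip x y * 2 = near nx x y * 2 -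
    near_k nx x * near_k nx y * (1 - arrow_k nx x * arrow_k nx y).
Proof.
move=> ox oy.
have [xh|[i ih xi]] := outerP ox.
  rewrite !(arrow_k_out xh).
  have [yh|[j jh ->]] := outerP oy.
    rewrite /arrow /near /follows !flip_out // !(arrow_k_out yh).
    by rewrite !(normr0, mulr0, mul0r, oppr0, addr0, subr0).
  have yh := six_mem jh; rewrite /arrow /near !(follows_out xh yh).
  by rewrite !(normr0, mulr0, mul0r, oppr0, addr0, subr0).
have [yh|[j jh yj]] := outerP oy.
  rewrite !(arrow_k_out yh).
  have xh := six_mem ih; rewrite xi /arrow /near !(follows_out yh xh).
  by rewrite !(normr0, mulr0, mul0r, oppr0, addr0, subr0).
have [a1 b1 _ _] := six_k ih; have [a2 b2 _ _] := six_k jh.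
rewrite xi yj a1 a2 b1 b2 /arrow /near.
by move: ih jh; rewrite !inE => /or4P[]/eqP-> /or4P[]/eqP->; rewrite !follows_six.
Qed.

End SixSides.

(** * The twin of a triangulation *)

Section Ribbon.
Variables (S : finType) (n : nat) (T : S -> option 'I_n) (sigma : S -> int).

Definition partner (x y : S) : bool := [&& x != y, T x != None & T x == T y].

(** A triangulation without punctures, together with an orientation of its dual
    graph, given by sigma. Crossing the side x into the glued side y and passing
    to the side after y is a rotation around the marked point at which x starts,
    so a rank h decreasing along it excludes full turns. *)
Record ribbon (nx : S -> S) (h : S -> nat) : Prop := Ribbon {
  ribbon3 : forall x, nx (nx (nx x)) = x;
  ribbon_neq : forall x, nx x != x;
  ribbon_two : forall i, #|[set x | T x == Some i]| = 2%N;
  ribbon_sq : forall x, sigma x * sigma x = 1;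
  ribbon_opp : forall x y, partner x y -> sigma y = - sigma x;
  ribbon_desc : forall x y, partner x y -> (h (nx y) < h x)%N }.

Definition ribbon_quiver (nx : S -> S) : 'M[int]_n :=
  \matrix_(i, j) \sum_(x | T x == Some i) \sum_(y | T y == Some j) arrow nx x y.

(** Off the diagonal, this is the Gram matrix of the vectors e_t - e_t' of the
    arcs. *)
Definition ribbon_companion (nx : S -> S) : 'M[int]_n :=
  \matrix_(i, j) if i == j then 2 else
    \sum_(x | T x == Some i) \sum_(y | T y == Some j)
      sigma x * sigma y * near nx x y.

Lemma ribbon_quiver_skew nx i j :
  ribbon_quiver nx i j = - ribbon_quiver nx j i.
Proof.
rewrite !mxE exchange_big -sumrN; apply: eq_bigr => x _.
by rewrite -sumrN; apply: eq_bigr => y _; rewrite opprB.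
Qed.

Lemma ribbon_companion_sym nx i j :
  ribbon_companion nx i j = ribbon_companion nx j i.
Proof.
rewrite !mxE eq_sym; case: ifP => // _.
rewrite exchange_big; apply: eq_bigr => x _; apply: eq_bigr => y _.
by rewrite /near addrC [sigma y * _]mulrC.
Qed.

Section Flip.
Variables (nx : S -> S) (h : S -> nat) (k : 'I_n) (k0 k1 : S).
Hypotheses (hR : ribbon nx h) (k01 : k0 != k1)
  (fiber_k : [set x | T x == Some k] = [set k0; k1]).

Let nx3 := ribbon3 hR.
Let nxn := ribbon_neq hR.

Lemma fiber_kE x : (T x == Some k) = (x == k0) || (x == k1).
Proof. by move/setP: fiber_k => /(_ x); rewrite !inE. Qed.

Lemma Tk0 : T k0 = Some k. Proof. by apply/eqP; rewrite fiber_kE eqxx. Qed.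
Lemma Tk1 : T k1 = Some k. Proof. by apply/eqP; rewrite fiber_kE eqxx orbT. Qed.

Lemma k10 : k1 != k0. Proof. by rewrite eq_sym. Qed.

Lemma partner_k : partner k0 k1 /\ partner k1 k0.
Proof. by rewrite /partner Tk0 Tk1 eqxx k01 k10. Qed.

(** Two sides of one triangle are consecutive; if they were glued, they would
    enclose a puncture. *)
Lemma k1a : k1 != nx k0.
Proof.
by apply/eqP=> e; have := ribbon_desc hR partner_k.2; rewrite -e ltnn.
Qed.
Lemma k1b : k1 != nx (nx k0).
Proof.
apply/eqP=> e; have := ribbon_desc hR partner_k.1.
by rewrite e nx3 ltnn.
Qed.

Lemma outer_fiber i x : i != k -> T x == Some i -> outer k0 k1 x.
Proof.
move=> ik /eqP Tx; have : T x != Some k by rewrite Tx.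
by rewrite fiber_kE negb_or.
Qed.

Lemma sum_k (F : S -> int) : \sum_(z | T z == Some k) F z = F k0 + F k1.
Proof.
rewrite (eq_bigl (fun z => z \in [set k0; k1])) => [|z]; last by rewrite fiber_kE !inE.
by rewrite big_setU1 ?big_set1 ?inE.
Qed.

(* The contribution of the side x to the entry of the companion at k. *)
Let nu x := sigma x * sigma k0 * near_k k0 k1 nx x.

Lemma quiver_k i nx' :
  ribbon_quiver nx' i k = \sum_(x | T x == Some i) arrow_k k0 k1 nx' x.
Proof. by rewrite mxE; apply: eq_bigr => x _; rewrite sum_k. Qed.

Lemma companion_k i nx' : i != k -> ribbon_companion nx' i k =
  \sum_(x | T x == Some i) sigma x * sigma k0 * near_k k0 k1 nx' x.
Proof.
move=> /negbTE ik; rewrite mxE ik; apply: eq_bigr => x _; rewrite sum_k.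
by rewrite (ribbon_opp hR partner_k.1) /near_k; ring.
Qed.

(** Two glued sides of the quadrilateral are opposite, and opposite sides
    contribute alike: glued consecutive sides would be a full turn around the
    vertex between them, against the decreasing rank. *)
Lemma partner_aligned x y : outer k0 k1 x -> outer k0 k1 y -> partner x y ->
  arrow_k k0 k1 nx x != 0 -> arrow_k k0 k1 nx y != 0 ->
  arrow_k k0 k1 nx x = arrow_k k0 k1 nx y /\ nu x = nu y.
Proof.
move=> ox oy pxy.
have pyx : partner y x.
  by move: pxy; rewrite /partner eq_sym => /and3P[-> ? /eqP<-]; rewrite eqxx andbT.
have out z := arrow_k_out nx3 nxn k10 k1a k1b (x := z).
have [xh|[i ih xi]] := outerP nx ox.
  by rewrite !(out _ xh).
have [yh|[j jh yj]] := outerP nx oy.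
  by rewrite !(out _ yh).
move=> _ _.
have [a1 b1 _ _] := six_k nx3 nxn k10 k1a k1b ih.
have [a2 b2 _ _] := six_k nx3 nxn k10 k1a k1b jh.
have dxy := ribbon_desc hR pxy; have dyx := ribbon_desc hR pyx.
have d01 := ribbon_desc hR partner_k.1; have d10 := ribbon_desc hR partner_k.2.
have sxy := ribbon_opp hR pxy.
have ij : i != j.
  by case/and3P: pxy => xy _ _; apply: contraNneq xy => ij; rewrite xi yj ij.
rewrite /nu sxy xi yj a1 a2 b1 b2.
(* Opposite sides satisfy the equations by computation; for consecutive ones the
   inequalities between ranks are contradictory. *)
move: ih jh xi yj ij; rewrite !inE => /or4P[]/eqP-> /or4P[]/eqP-> xi yj //= _;
 rewrite {}xi {}yj /six /= ?nx3 in dxy dyx; try (by split; ring); lia.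
Qed.

Let nxk := flip nx k0 k1.
Let b := arrow_k k0 k1 nx.

Lemma arrow_k_cases x : outer k0 k1 x ->
  (b x = 0 /\ nu x = 0) \/ [/\ b x * b x = 1, nu x * nu x = 1 & `|b x| = 1].
Proof.
move=> ox; rewrite /b /nu; have [xh|[i ih ->]] := outerP nx ox.
  by left; rewrite !(arrow_k_out nx3 nxn k10 k1a k1b xh) mulr0.
right; have [-> -> _ _] := six_k nx3 nxn k10 k1a k1b ih.
rewrite -expr2 sqrr_sign -expr2 exprMn sqrr_sign exprMn !expr2.
by rewrite !(ribbon_sq hR) !mul1r normrX normrN1 expr1n.
Qed.

(** The two sides of an arc i never cancel in row i of column k, neither in the
    quiver nor in the companion. *)
Lemma aligned i : i != k -> exists d e : int,
  [/\ d * d = 1, e * e = 1 &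
    forall x, T x == Some i -> b x = d * `|b x| /\ nu x = e * `|b x|].
Proof.
move=> ik; have [|none] := boolP [exists x, (T x == Some i) && (b x != 0)]; last first.
  exists 1, 1; split=> // x Tx; have ox := outer_fiber ik Tx.
  have [[-> ->]|[bx _ _]] := arrow_k_cases ox; first by rewrite normr0 mulr0.
  move: none; rewrite negb_exists => /forallP/(_ x); rewrite Tx negbK => /eqP b0.
  by rewrite b0 mulr0 in bx.
case/existsP=> x0 /andP[T0 b0]; have o0 := outer_fiber ik T0.
have [[z0 _]|[bb nn _]] := arrow_k_cases o0; first by rewrite z0 in b0.
exists (b x0), (nu x0); split=> // x Tx; have ox := outer_fiber ik Tx.
have [[-> ->]|[bx _ ->]] := arrow_k_cases ox; first by rewrite normr0 !mulr0.
rewrite !mulr1; case: (eqVneq x x0) => [->//|xx0].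
apply: partner_aligned => //.
  by rewrite /partner xx0 (eqP Tx) (eqP T0) eqxx.
by apply/eqP=> bx0; move: bx; rewrite /b bx0 mul0r.
Qed.

Let U i := \sum_(x | T x == Some i) `|b x|.

Lemma entries_k i : i != k -> exists d e : int,
  [/\ d * d = 1, e * e = 1, 0 <= U i,
     ribbon_quiver nx i k = d * U i /\ ribbon_companion nx i k = e * U i
   & ribbon_quiver nxk i k = - (d * U i) /\ ribbon_companion nxk i k = d * e * U i].
Proof.
move=> ik; have [d [e [dd ee al]]] := aligned ik; exists d, e.
split=> //; first by apply: sumr_ge0.
  rewrite quiver_k companion_k // /U !mulr_sumr; split; apply: eq_bigr => x /al.
    by case=> <-.
  by case=> _ <-.
rewrite quiver_k companion_k // /U !mulr_sumr -sumrN.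
split; apply: eq_bigr => x Tx; have ox := outer_fiber ik Tx;
  have [e1 e2] := flip_arrow_k nx3 nxn k10 k1a k1b ox; have [bx nx'] := al x Tx.
  by rewrite e1 -/b -bx.
rewrite e2 -/b.
have -> : sigma x * sigma k0 * (b x * near_k k0 k1 nx x) = b x * nu x.
  by rewrite /nu; ring.
have [[b0 _]|[_ _ n1]] := arrow_k_cases ox; first by rewrite b0 normr0 !(mulr0, mul0r).
by rewrite n1 !mulr1 in bx nx' *; rewrite -bx -nx'.
Qed.

Lemma mutate_ribbon_quiver :
  mutate_quiver k (ribbon_quiver nx) = ribbon_quiver nxk.
Proof.
have diag nx' i : ribbon_quiver nx' i i = 0.
  by have := ribbon_quiver_skew nx' i i; lia.
have col i : ribbon_quiver nxk i k = - ribbon_quiver nx i k.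
  case: (eqVneq i k) => [->|ik]; first by rewrite !diag oppr0.
  by have [d [e [_ _ _ [-> _] [-> _]]]] := entries_k ik.
apply/matrixP=> i j; case: (eqVneq j k) => [->|jk].
  by rewrite mutate_quiver_at ?eqxx ?orbT // col.
case: (eqVneq i k) => [->|ik].
  by rewrite mutate_quiver_at ?eqxx // ribbon_quiver_skew -col -ribbon_quiver_skew.
rewrite mxE (negbTE ik) (negbTE jk) /=; apply: (@mulIf _ 2) => //.
rewrite mulrDl quiver_correction_double.
rewrite (ribbon_quiver_skew nx k j) !normrN.
have norm l : l != k -> `|ribbon_quiver nx l k| = \sum_(x | T x == Some l) `|b x|.
  move=> lk; have [d [e [dd _ U0 [-> _] _]]] := entries_k lk.
  by rewrite normrM (ger0_norm U0); case: (sq_unit dd) => ->; rewrite mul1r.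
rewrite !norm // !quiver_k !mxE !mulr_suml -!big_split /=.
apply: eq_bigr => x Tx; rewrite -sumrN !mulr_sumr !mulr_suml -!big_split /=.
apply: eq_bigr => y Ty.
by have [-> _] := flip_arrow nx3 nxn k10 k1a k1b (outer_fiber ik Tx) (outer_fiber jk Ty).
Qed.

Lemma mutate_ribbon_companion :
  mutate_companion k (ribbon_quiver nx) (ribbon_companion nx) = ribbon_companion nxk.
Proof.
have col i : i != k -> ribbon_companion nxk i k =
    Num.sg (ribbon_quiver nx i k) * ribbon_companion nx i k.
  move=> ik; have [d [e [dd _ U0 [-> ->] [_ ->]]]] := entries_k ik.
  have -> : Num.sg (d * U i) * (e * U i) = Num.sg d * e * (Num.sg (U i) * U i).
    by rewrite sgrM; ring.
  by rewrite -normrEsg (ger0_norm U0); case: (sq_unit dd) => ->; rewrite ?sgrN sgr1.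
apply/matrixP=> i j; rewrite mxE; case: (eqVneq i j) => [->|ij].
  by rewrite mxE eqxx.
case: (eqVneq j k) (ij) => [->|jk] ij'; first by rewrite col.
case: (eqVneq i k) (ij') => [->|ik] kj.
  by rewrite (ribbon_companion_sym nxk) col // eq_sym.
apply: (@mulIf _ 2) => //.
have -> : ribbon_companion nxk i j * 2 = ribbon_companion nx i j * 2 -
   ribbon_companion nx i k * ribbon_companion nx j k +
   ribbon_companion nxk i k * ribbon_companion nxk j k.
  rewrite !companion_k // !mxE (negbTE ij) !mulr_suml -sumrN -!big_split /=.
  apply: eq_bigr => x Tx; rewrite !mulr_sumr !mulr_suml -sumrN -!big_split /=.
  apply: eq_bigr => y Ty.
  have ox := outer_fiber ik Tx; have oy := outer_fiber jk Ty.
  have [_ h2] := flip_arrow nx3 nxn k10 k1a k1b ox oy.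
  have [_ ->] := flip_arrow_k nx3 nxn k10 k1a k1b ox.
  have [_ ->] := flip_arrow_k nx3 nxn k10 k1a k1b oy.
  rewrite -[LHS]mulrA h2.
  set p := near_k _ _ _ x; set q := near_k _ _ _ y.
  set u := arrow_k _ _ _ x; set v := arrow_k _ _ _ y.
  have -> : p * q * (1 - u * v) = (sigma k0 * sigma k0) * (p * q * (1 - u * v)).
    by rewrite (ribbon_sq hR) mul1r.
  ring.
rewrite (ribbon_quiver_skew nx k j) (ribbon_companion_sym nx k j).
have [d1 [e1 [dd1 ee1 U1 [-> ->] [_ ->]]]] := entries_k ik.
have [d2 [e2 [dd2 ee2 U2 [-> ->] [_ ->]]]] := entries_k jk.
have ee : e1 * e2 * (e1 * e2) = 1 by rewrite mulrACA ee1 ee2.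
have dd : d1 * d2 * (d1 * d2) = 1 by rewrite mulrACA dd1 dd2.
have corr := companion_correction_double ee dd (mulr_ge0 U1 U2).
have -> : e1 * U i * (e2 * U j) = e1 * e2 * (U i * U j) by ring.
have -> : d1 * U i * - (d2 * U j) = - (d1 * d2 * (U i * U j)) by ring.
rewrite mulrBl corr; ring.
Qed.

(** The flip inserts a corner at the start of k0 between those of side 4's glued
    side and of side 5, and one at the start of k1 between those of side 1's
    glued side and of side 2. Doubling all ranks makes room for them. *)
Lemma flip_ribbon : exists h', ribbon nxk h'.
Proof.
pose h' x := if x == k0 then (2 * h (nx (nx k1)) + 1)%N
  else if x == k1 then (2 * h (nx (nx k0)) + 1)%N else (2 * h x)%N.
have h0 : h' k0 = (2 * h (nx (nx k1)) + 1)%N by rewrite /h' eqxx.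
have h1 : h' k1 = (2 * h (nx (nx k0)) + 1)%N by rewrite /h' eqxx (negbTE k10).
have ho x : outer k0 k1 x -> h' x = (2 * h x)%N.
  by rewrite /h' => /andP[/negbTE-> /negbTE->].
have oc i : i \in [:: 1; 2; 4; 5]%N -> outer k0 k1 (six nx k0 k1 i).
  exact: (outer_six nx3 nxn k10 k1a k1b).
exists h'; split; try by case: hR.
- exact: (flip3 nx3 nxn k10 k1a k1b).
- exact: (flip_neq nx3 nxn k10 k1a k1b).
move=> x y pxy; have desc := ribbon_desc hR pxy.
have d01 := ribbon_desc hR partner_k.1; have d10 := ribbon_desc hR partner_k.2.
have fc i := flip_six nx3 nxn k10 k1a k1b (i := i).
have [xy _ /eqP Txy] := and3P pxy.
case: (boolP (outer k0 k1 y)) => [oy|]; last first.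
  rewrite /outer negb_and !negbK -fiber_kE => Ty.
  have Tx : T x == Some k by rewrite Txy.
  move: xy Tx Ty; rewrite !fiber_kE => + /orP[]/eqP xk /orP[]/eqP yk;
    rewrite xk yk ?eqxx // => _.
    by rewrite h0 /nxk [X in flip _ _ _ X](k_six nx k0 k1).2 fc // ho ?oc //= addn1.
  by rewrite h1 /nxk [X in flip _ _ _ X](k_six nx k0 k1).1 fc // ho ?oc //= addn1.
have ox : outer k0 k1 x.
  by move: oy; rewrite /outer -!negb_or -!fiber_kE Txy.
rewrite (ho x ox).
have [yh|[i ih yi]] := outerP nx oy.
  rewrite /nxk flip_out // ho ?ltn_pmul2l //.
  rewrite /outer; apply/andP; split; apply: contraNneq yh => yk.
    by rewrite -mem_six_nx // yk; exact: mem_head.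
  by rewrite -mem_six_nx // yk !inE eqxx !orbT.
move: ih yi desc; rewrite !inE => /or4P[]/eqP-> ->; rewrite /nxk fc //=.
- rewrite -[h' _]/(h' k1) h1 /six /=; lia.
- rewrite ho ?oc // /six /= nx3; lia.
- rewrite -[h' _]/(h' k0) h0 /six /=; lia.
rewrite ho ?oc // /six /= nx3; lia.
Qed.

End Flip.

Lemma ribbon_fiber nx h k : ribbon nx h ->
  exists k0 k1, k0 != k1 /\ [set x | T x == Some k] = [set k0; k1].
Proof.
by move=> hR; apply/cards2P/eqP; exact: ribbon_two hR k.
Qed.

Lemma ribbon_quasi_Cartan nx h : ribbon nx h ->
  quasi_Cartan_companion (ribbon_quiver nx) (ribbon_companion nx).
Proof.
move=> hR; split=> [|i|i k ik].
- by apply/matrixP=> i j; rewrite mxE ribbon_companion_sym.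
- by rewrite mxE eqxx.
have [k0 [k1 [k01 fk]]] := ribbon_fiber k hR.
have [d [e [dd ee _ [-> ->] _]]] := entries_k hR k01 fk ik.
by rewrite !normrM; case: (sq_unit dd) => ->; case: (sq_unit ee) => ->.
Qed.

(** Signed ribbon structures are closed under flips, and each of them gives a
    companion. *)
Lemma ribbon_twin nx h : ribbon nx h ->
  symmetric_twin (ribbon_quiver nx) (ribbon_companion nx).
Proof.
move=> hR; split=> [|ks]; first exact: ribbon_quasi_Cartan hR.
elim: ks nx h hR => [|k ks IH] nx h hR /=; first exact: ribbon_quasi_Cartan hR.
have [k0 [k1 [k01 fk]]] := ribbon_fiber k hR.
have [h' hR'] := flip_ribbon hR k01 fk.
rewrite /mutate /= (mutate_ribbon_quiver hR k01 fk).
by rewrite (mutate_ribbon_companion hR k01 fk); apply: IH hR'.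
Qed.

End Ribbon.

(** * Triangulations without punctures *)

Section Acyclic.
Variables (V : finType) (e : rel V).
Hypothesis e_fun : forall x y z, e x y -> e x z -> y = z.

Definition on_cycle x := [exists y, e x y && connect e y x].

Lemma on_cycle_step x y : on_cycle x -> e x y -> on_cycle y.
Proof.
case/existsP=> y' /andP[xy' y'x] xy; have yy' := e_fun xy xy'; subst y'.
case/connectP: y'x => [[|z p] /= yp ey]; apply/existsP.
  by subst x; exists y; rewrite xy connect0.
case/andP: yp => yz zp; exists z; rewrite yz /=.
apply: connect_trans (connect1 xy); apply/connectP; by exists p.
Qed.

End Acyclic.

Lemma on_cycle_rev (V : finType) (e : rel V) x :
  on_cycle e x -> on_cycle (fun x y => e y x) x.
Proof.
case/existsP=> y /andP[xy yx]; apply/existsP.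
have : connect (fun x y => e y x) x y by rewrite connect_rev.
case/connectP=> [[|z p] /= xp ey].
  by subst y; exists x; rewrite xy connect0.
case/andP: xp => zx zp; exists z; rewrite zx /=.
apply: (connect_trans (y := y)); last exact: connect1.
by apply/connectP; exists p.
Qed.

(** Rank x by the number of elements that are reachable from it; x itself is not
    reachable from its successors. *)
Lemma acyclic_rank (V : finType) (e : rel V) : (forall x, ~~ on_cycle e x) ->
  exists h : V -> nat, forall x y, e x y -> (h y < h x)%N.
Proof.
move=> acyc; exists (fun x => #|connect e x|) => x y xy.
apply/proper_card/properP; split.
  by apply/subsetP=> z; apply/connect_trans/connect1.
exists x; first exact: connect0.
apply: contra (acyc x) => yx.
by apply/existsP; exists y; rewrite xy.
Qed.

Section Triangulation.
Variables (m n : nat) (T : side m -> option 'I_n).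
Hypothesis hT : unpunctured_triangulation T.

Lemma next_side3 (s : side m) : next_side (next_side (next_side s)) = s.
Proof.
case: s => t [i i3]; rewrite /next_side /=; congr (_, _); apply: val_inj.
by case: i i3 => [|[|[|i]]].
Qed.

Lemma next_side_neq (s : side m) : next_side s != s.
Proof. by case: s => t [[|[|[|i]]] i3]; rewrite /next_side xpair_eqE eqxx. Qed.

Lemma next_side_inj : injective (@next_side m).
Proof. by move=> x y xy; rewrite -[x]next_side3 -[y]next_side3 xy. Qed.

Lemma glued_unique x y z : glued T x y -> glued T x z -> y = z.
Proof.
move=> /and3P[xy Tx /eqP Txy] /and3P[xz _ /eqP Txz].
case e: (T x) Tx => [i|] // _; have [_ two _ _] := hT.
have /eqP/cards2P[a [b [_ /setP F]]] := two i.
have mem t : Some i = T t -> (t == a) || (t == b).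
  by move=> e'; move: (F t); rewrite !inE -e' eqxx.
rewrite e in Txy Txz; move: (mem x (esym e)) (mem y Txy) (mem z Txz) xy xz.
by do 3! case/orP=> /eqP->; rewrite ?eqxx.
Qed.

Lemma glued_sym x y : glued T x y = glued T y x.
Proof.
rewrite /glued eq_sym [T x == T y]eq_sym.
by case: (T y =P T x) => [->|]; rewrite ?andbF.
Qed.

(** The rotation around marked points is a partial injection, so being on a
    cycle of it is constant on each marked point. But at a marked point on the
    boundary the rotation has a first and a last corner, at boundary
    segments. *)
Lemma no_puncture c : ~~ on_cycle (corner_glued T) c.
Proof.
have [_ _ _ bd] := hT.
have ff x y z : corner_glued T x y -> corner_glued T x z -> y = z.
  case/existsP=> u /andP[xu /eqP->] /existsP[v /andP[xv /eqP->]].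
  by rewrite (glued_unique xu xv).
have fb y x z : corner_glued T x y -> corner_glued T z y -> x = z.
  case/existsP=> u /andP[xu /eqP->] /existsP[v /andP[zv /eqP/next_side_inj uv]].
  by subst v; rewrite glued_sym in xu; rewrite glued_sym in zv; exact: glued_unique xu zv.
apply/negP=> cyc; have [s /andP[/eqP Ts cs]] := existsP (bd c).
have inv d : same_point T c d -> on_cycle (corner_glued T) d.
  case/connectP=> p; elim: p c cyc {cs} => [|d' p IH] c cyc /=; first by move=> _ ->.
  case/andP=> /orP[cd|dc]; apply: IH; first exact: on_cycle_step ff _ _ cyc cd.
  apply/on_cycle_rev/(on_cycle_step _ (on_cycle_rev cyc) dc) => x y z.
  exact: fb.
case/orP: cs => /inv; first case/existsP=> d /andP[/existsP[u]].
  by rewrite /glued Ts andbF.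
move/on_cycle_rev/existsP=> [d /andP[/existsP[u /andP[du /eqP/next_side_inj us]]]].
by subst u; move: du; rewrite glued_sym /glued Ts andbF.
Qed.

Lemma arrows_sum i j : (arrows T i j)%:Z = \sum_(x | T x == Some i)
  \sum_(y | T y == Some j) follows (@next_side m) x y.
Proof.
rewrite /arrows -sum1_card -[_%:Z]natz natr_sum.
rewrite big_mkcond [RHS]big_mkcond; apply: eq_bigr => x _.
rewrite inE; case: (T x == Some i) => //=.
rewrite big_mkcond (bigD1 (next_side x)) //= big1 => [|y /negbTE ne].
  by rewrite addr0 /follows eqxx; case: ifP.
by rewrite /follows [next_side x == y]eq_sym ne; case: ifP.
Qed.

Lemma triangulation_ribbon :
  exists sigma h, ribbon T sigma (@next_side m) h.
Proof.
have [h hh] := acyclic_rank no_puncture.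
(* The sign is 1 on one selected side of each arc. *)
pose first (s : side m) := [pick x | T x == T s].
exists (fun s => if first s == Some s then 1 else -1), h; split.
- exact: next_side3.
- exact: next_side_neq.
- by case: hT.
- by move=> s; case: ifP.
- move=> x y pxy.
  have [xy Tx /eqP Txy] := and3P pxy.
  have fxy : first x = first y by rewrite /first Txy.
  rewrite -fxy; case fx: (first x) => [z|]; last first.
    by move: fx; rewrite /first; case: pickP => // /(_ x); rewrite eqxx.
  have Tz : T z = T x by move: fx; rewrite /first; case: pickP => // w /eqP Tw [<-].
  have [->|zx] := eqVneq z x; first by rewrite eqxx (inj_eq Some_inj) (negbTE xy).
  rewrite !(inj_eq Some_inj) (negbTE zx); case: eqP => [_ //|[]].
  apply: (@glued_unique x).
    by rewrite /glued eq_sym zx Tx Tz eqxx.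
  exact: pxy.
move=> x y pxy; apply: hh; apply/existsP; exists y; rewrite eqxx andbT.
exact: pxy.
Qed.

Lemma triangulation_quiver :
  ribbon_quiver T (@next_side m) = quiver_of_triangulation T.
Proof.
apply/matrixP=> i j; rewrite !mxE !arrows_sum.
rewrite [X in _ - X]exchange_big -sumrN -big_split; apply: eq_bigr => x _.
by rewrite -sumrN -big_split.
Qed.

End Triangulation.

Theorem corollary6p4 (m n : nat) (T : side m -> option 'I_n)
    (hT : unpunctured_triangulation T) :
  (exists A : 'M[int]_n, symmetric_twin (quiver_of_triangulation T) A) /\
  (forall A A' : 'M[int]_n,
     symmetric_twin (quiver_of_triangulation T) A ->
     symmetric_twin (quiver_of_triangulation T) A' ->
     exists eps : 'I_n -> int,
       (forall i, eps i = 1 \/ eps i = -1) /\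
       (forall i j, A' i j = eps i * eps j * A i j)).
Proof.
split=> [|A A']; last exact: twin_unique (quiver_of_triangulationP T).
have [sigma [h hR]] := triangulation_ribbon hT.
by eexists; rewrite -triangulation_quiver; exact: ribbon_twin hR.
Qed.
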